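(* Let $A, B\in \mathbb{C}^{m\times n}$ be such that $BA^*=0$ (that is, $A$ is right $*$-orthogonal to $B$) and $\mathcal{R}(A)\cap \mathcal{R}(B)=\{0\}$. Then $$(A+B)^\dagger=(A+B)^*\left([(\overline{P}_A B)(\overline{P}_A B)^*]^\dagger+[(\overline{P}_B A)(\overline{P}_B A)^*]^\dagger\right).$$
   Context: $M^*$ is the conjugate transpose, $\mathcal{R}(M)$ the column space, and $M^\dagger$ the Moore-Penrose inverse of $M$. For a matrix $M$ with $m$ rows, $\overline{P}_M=I_m-MM^\dagger$. *)

(* Defs.v *)
From mathcomp Require Import all_boot all_order all_algebra.
From mathcomp Require Import classical_sets reals complex.

Set Implicit Arguments.
Unset Strict Implicit.
Unset Printing Implicit Defensive.

Import Order.TTheory GRing.Theory Num.Theory.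
Local Open Scope ring_scope.
Local Open Scope sesquilinear_scope.

(* [M ^t*], from mathcomp's spectral.v, is the conjugate transpose of M.      *)

Section MoorePenrose.
Variable C : numClosedFieldType.

(* The four Penrose equations. *)
Definition is_mpinv m n (M : 'M[C]_(m, n)) (X : 'M[C]_(n, m)) : bool :=
  [&& M *m X *m M == M,
      X *m M *m X == X,
      (M *m X) ^t* == M *m X &
      (X *m M) ^t* == X *m M].

Lemma adjmxM m n p (A : 'M[C]_(m, n)) (B : 'M[C]_(n, p)) :
  (A *m B) ^t* = B ^t* *m A ^t*.
Proof. by rewrite trmx_mul map_mxM. Qed.

Lemma mulmx_adj_eq0 m n (A : 'M[C]_(m, n)) : A *m A ^t* = 0 -> A = 0.
Proof.
move=> AA0; apply/matrixP=> i j; rewrite mxE.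
have /eqP := congr1 (fun M : 'M_m => M i i) AA0; rewrite !mxE.
rewrite psumr_eq0 => [/allP/(_ j)|k _].
  by rewrite mem_index_enum !mxE mul_conjC_eq0 => /(_ isT) /eqP.
by rewrite !mxE mul_conjC_ge0.
Qed.

Lemma row_free_unit_gram m n (A : 'M[C]_(m, n)) :
  row_free A -> A *m A ^t* \in unitmx.
Proof.
move=> fA; rewrite -row_free_unit -kermx_eq0; apply/eqP.
set K := kermx _; have K0 : K *m (A *m A ^t*) = 0 by exact: mulmx_ker.
apply/eqP; rewrite -(mulmx_free_eq0 K fA); apply/eqP/mulmx_adj_eq0.
by rewrite adjmxM !mulmxA -(mulmxA K) K0 mul0mx.
Qed.

Lemma is_mpinv_uniq m n (M : 'M[C]_(m, n)) (X Y : 'M[C]_(n, m)) :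
  is_mpinv M X -> is_mpinv M Y -> X = Y.
Proof.
move=> /and4P[/eqP X1 /eqP X2 /eqP X3 /eqP X4].
move=> /and4P[/eqP Y1 /eqP Y2 /eqP Y3 /eqP Y4].
have eqL : M *m X = M *m Y.
  have -> : M *m X = M *m Y *m (M *m X) by rewrite mulmxA Y1.
  by rewrite -Y3 -X3 -adjmxM mulmxA X1.
have eqR : X *m M = Y *m M.
  have -> : X *m M = X *m M *m (Y *m M) by rewrite -mulmxA (mulmxA M) Y1.
  by rewrite -X4 -Y4 -adjmxM -mulmxA (mulmxA M) X1.
by rewrite -X2 eqR -mulmxA eqL mulmxA Y2.
Qed.

Lemma is_mpinv_exists m n (M : 'M[C]_(m, n)) : exists X, is_mpinv M X.
Proof.
have [r [F [G [FG fF fG]]]] : exists r (F : 'M_(m, r)) (G : 'M_(r, n)),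
    [/\ F *m G = M, row_full F & row_free G].
  exists (\rank M), (col_base M), (row_base M).
  by split; [exact: mulmx_base | exact: col_base_full | exact: row_base_free].
have uG : G *m G ^t* \in unitmx by exact: row_free_unit_gram.
have uF : F ^t* *m F \in unitmx.
  rewrite -{2}(trmxCK F); apply: row_free_unit_gram.
  by rewrite /row_free mxrank_map mxrank_tr.
pose H := invmx (G *m G ^t*); pose K := invmx (F ^t* *m F).
have HC : H ^t* = H by rewrite /H trmx_inv map_invmx adjmxM trmxCK.
have KC : K ^t* = K by rewrite /K trmx_inv map_invmx adjmxM trmxCK.
exists (G ^t* *m H *m K *m F ^t*).
have MX : M *m (G ^t* *m H *m K *m F ^t*) = F *m K *m F ^t*.
  by rewrite -FG !mulmxA -(mulmxA F G) -(mulmxA F _ H) mulmxV // mulmx1.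
have XM : (G ^t* *m H *m K *m F ^t*) *m M = G ^t* *m H *m G.
  by rewrite -FG !mulmxA -(mulmxA _ (F ^t*) F) -(mulmxA _ K) mulVmx // mulmx1.
apply/and4P; split; apply/eqP.
- by rewrite MX -FG !mulmxA -(mulmxA _ (F ^t*) F) -(mulmxA F K) mulVmx // mulmx1.
- by rewrite XM !mulmxA -(mulmxA _ G) -(mulmxA _ (G *m _)) mulmxV // mulmx1.
- by rewrite MX !adjmxM trmxCK KC mulmxA.
- by rewrite XM !adjmxM trmxCK HC mulmxA.
Qed.

Definition mpinv m n (M : 'M[C]_(m, n)) : 'M[C]_(n, m) :=
  xchoose (is_mpinv_exists M).

Lemma mpinvP m n (M : 'M[C]_(m, n)) : is_mpinv M (mpinv M).
Proof. exact: xchooseP. Qed.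

Definition compl_proj m n (M : 'M[C]_(m, n)) : 'M[C]_m := 1%:M - M *m mpinv M.

Definition col_space m n (M : 'M[C]_(m, n)) : set 'cV[C]_m :=
  range (fun x : 'cV[C]_n => M *m x).

End MoorePenrose.

(* Main.v *)
(** Write [P], [Q] for the complementary projections of [A], [B], and
    [M^H] for the adjoint of [M]. Put [X = (P B)^+] and [Y = (Q A)^+]. Since
    [((P B) (P B)^H)^+ = X^H X] and [X = X P], so that [X A = 0] and
    [X B = X P B], the right-hand side collapses to [X + Y]. It remains to check
    the Penrose equations for [X + Y]. Star-orthogonality gives [A X = B Y = 0];
    trivial intersection of the ranges gives [B X B = B] and [A Y A = A]. Hence
    [E = (A + B) (X + Y) = B X + A Y] fixes [A] and [B], which forces
    [X E^H = X] and [Y E^H = Y], so [E = E E^H] is Hermitian. *)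
Require Import Defs.
From mathcomp Require Import all_boot all_order all_algebra.
From mathcomp Require Import classical_sets reals complex.

Import GRing.Theory.
Local Open Scope ring_scope.
Local Open Scope classical_set_scope.
Local Open Scope sesquilinear_scope.

Section MoorePenroseTheory.
Set Implicit Arguments.
Unset Strict Implicit.
Context {C : numClosedFieldType}.

Lemma adjmxD m n (M N : 'M[C]_(m, n)) : (M + N) ^t* = M ^t* + N ^t*.
Proof. by rewrite linearD map_mxD. Qed.

Lemma mulmx_mpinvK m n (M : 'M[C]_(m, n)) : M *m mpinv M *m M = M.
Proof. by case/and4P: (mpinvP M) => /eqP. Qed.

Lemma mpinv_mulmxK m n (M : 'M[C]_(m, n)) : mpinv M *m M *m mpinv M = mpinv M.
Proof. by case/and4P: (mpinvP M) => _ /eqP. Qed.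

Lemma adjmx_mulmx_mpinv m n (M : 'M[C]_(m, n)) :
  (M *m mpinv M) ^t* = M *m mpinv M.
Proof. by case/and4P: (mpinvP M) => _ _ /eqP. Qed.

Lemma adjmx_mpinv_mulmx m n (M : 'M[C]_(m, n)) :
  (mpinv M *m M) ^t* = mpinv M *m M.
Proof. by case/and4P: (mpinvP M) => _ _ _ /eqP. Qed.

(** Hermitian symmetry of [mpinv M *m M] exposes [M ^t*] as a left factor, so whatever annihilates
    [M ^t*] from the left also annihilates [mpinv M]. *)
Lemma mpinv_adjl m n (M : 'M[C]_(m, n)) :
  mpinv M = M ^t* *m (mpinv M) ^t* *m mpinv M.
Proof. by rewrite -adjmxM adjmx_mpinv_mulmx mpinv_mulmxK. Qed.

Lemma mpinv_adjr m n (M : 'M[C]_(m, n)) :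
  mpinv M = mpinv M *m (mpinv M) ^t* *m M ^t*.
Proof. by rewrite -mulmxA -adjmxM adjmx_mulmx_mpinv mulmxA mpinv_mulmxK. Qed.

(** Both products of the Gram matrix with the candidate collapse to the Hermitian projector
    [M *m mpinv M], which reduces the Penrose equations to those of [M]. *)
Lemma mpinv_gram m n (M : 'M[C]_(m, n)) :
  mpinv (M *m M ^t*) = (mpinv M) ^t* *m mpinv M.
Proof.
set X := mpinv M.
have GX : M *m M ^t* *m (X ^t* *m X) = M *m X.
  by rewrite -mulmxA (mulmxA (M ^t*)) -mpinv_adjl.
have XG : X ^t* *m X *m (M *m M ^t*) = M *m X.
  by rewrite -mulmxA (mulmxA X) -(adjmx_mpinv_mulmx M) -!adjmxM mulmxA
    mulmx_mpinvK adjmx_mulmx_mpinv.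
apply: is_mpinv_uniq (mpinvP _) _; apply/and4P; split; apply/eqP.
- by rewrite GX mulmxA mulmx_mpinvK.
- by rewrite XG -adjmx_mulmx_mpinv mulmxA -adjmxM mulmxA mpinv_mulmxK.
- by rewrite GX adjmx_mulmx_mpinv.
- by rewrite XG adjmx_mulmx_mpinv.
Qed.

Lemma adjmx_compl_proj m n (M : 'M[C]_(m, n)) :
  (compl_proj M) ^t* = compl_proj M.
Proof.
by rewrite /compl_proj linearB /= map_mxB trmx1 map_mx1 adjmx_mulmx_mpinv.
Qed.

Lemma compl_proj_mulmx m n (M : 'M[C]_(m, n)) : compl_proj M *m M = 0.
Proof. by rewrite mulmxBl mul1mx mulmx_mpinvK subrr. Qed.

Lemma compl_proj_idem m n (M : 'M[C]_(m, n)) :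
  compl_proj M *m compl_proj M = compl_proj M.
Proof.
by rewrite {2}/compl_proj mulmxBr mulmx1 mulmxA compl_proj_mulmx mul0mx subr0.
Qed.

(** Each column of the common product lies in both ranges. *)
Lemma col_space_disjoint_eq0 m n p (A B : 'M[C]_(m, n)) (U V : 'M[C]_(n, p)) :
  col_space A `&` col_space B = [set 0] -> A *m U = B *m V -> B *m V = 0.
Proof.
move=> hAB eqAB; apply/matrixP => i j.
have : (col_space A `&` col_space B) (col j (B *m V)).
  split; last by exists (col j V); rewrite // !colE mulmxA.
  by exists (col j U); rewrite // -eqAB !colE mulmxA.
by rewrite hAB /= => /matrixP/(_ i ord0); rewrite !mxE.
Qed.

Section ComplProjMpinv.
Variables (m n : nat) (A B : 'M[C]_(m, n)).
Let X := mpinv (compl_proj A *m B).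

Lemma mpinv_compl_projr : X *m compl_proj A = X.
Proof.
by rewrite /X mpinv_adjr adjmxM adjmx_compl_proj -!mulmxA compl_proj_idem.
Qed.

Lemma mpinv_compl_proj_mul0 : X *m A = 0.
Proof. by rewrite -mpinv_compl_projr -mulmxA compl_proj_mulmx mulmx0. Qed.

Lemma mpinv_compl_proj_mul : X *m B = X *m (compl_proj A *m B).
Proof. by rewrite mulmxA mpinv_compl_projr. Qed.

(** The left factor of [X] is [B ^t* *m compl_proj A], the adjoint of [compl_proj A *m B]. *)
Lemma mul_mpinv_compl_proj0 : A *m B ^t* = 0 -> A *m X = 0.
Proof.
by move=> AB0; rewrite /X mpinv_adjl adjmxM !mulmxA AB0 !mul0mx.
Qed.

Lemma mul_mpinv_compl_projK :
  col_space A `&` col_space B = [set 0] -> B *m X *m B = B.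
Proof.
move=> hAB; apply/esym/eqP; rewrite -subr_eq0.
have -> : B - B *m X *m B = B *m (1%:M - X *m B).
  by rewrite mulmxBr mulmx1 mulmxA.
apply/eqP.
(* [compl_proj A] kills [B *m (1%:M - X *m B)] because [X *m B = X *m (compl_proj A *m B)]; hence
   that matrix equals its image under [A *m mpinv A], which gives the witness. *)
apply: (@col_space_disjoint_eq0 _ _ _ A B (mpinv A *m B *m (1%:M - X *m B))) => //.
apply/esym/eqP; rewrite -subr_eq0 !mulmxA -!mulmxBl.
have -> : B - A *m mpinv A *m B = compl_proj A *m B.
  by rewrite mulmxBl mul1mx.
by rewrite mulmxBr mulmx1 mpinv_compl_proj_mul (mulmxA _ X)
  mulmx_mpinvK subrr.
Qed.

Lemma mpinv_compl_proj_gram :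
  (A + B) ^t* *m mpinv ((compl_proj A *m B) *m (compl_proj A *m B) ^t*) = X.
Proof.
rewrite mpinv_gram -/X mulmxA -adjmxM mulmxDr mpinv_compl_proj_mul0 add0r.
by rewrite mpinv_compl_proj_mul /X adjmx_mpinv_mulmx mpinv_mulmxK.
Qed.

(** [X] ends in the adjoint of [compl_proj A *m B = B - A *m mpinv A *m B], which [E] fixes since it
    fixes both [A] and [B]. *)
Lemma mpinv_compl_proj_adj_fix (E : 'M[C]_m) :
  E *m A = A -> E *m B = B -> X *m E ^t* = X.
Proof.
move=> EA EB; rewrite /X mpinv_adjr -mulmxA -adjmxM; congr (_ *m _ ^t*).
by rewrite mulmxBl mul1mx mulmxBr EB !mulmxA EA.
Qed.

End ComplProjMpinv.

Lemma mpinv_add_star_orthogonal m n (A B : 'M[C]_(m, n)) :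
  B *m A ^t* = 0 -> col_space A `&` col_space B = [set 0] ->
  mpinv (A + B) = mpinv (compl_proj A *m B) + mpinv (compl_proj B *m A).
Proof.
move=> BA0 hAB; have hBA := hAB; rewrite setIC in hBA.
have AB0 : A *m B ^t* = 0.
  by rewrite -(trmxCK (A *m B ^t*)) adjmxM trmxCK BA0 trmx0 map_mx0.
set X := mpinv (compl_proj A *m B); set Y := mpinv (compl_proj B *m A).
have AX0 : A *m X = 0 by exact: mul_mpinv_compl_proj0.
have BY0 : B *m Y = 0 by exact: mul_mpinv_compl_proj0.
have XA0 : X *m A = 0 by exact: mpinv_compl_proj_mul0.
have YB0 : Y *m B = 0 by exact: mpinv_compl_proj_mul0.
have BXB : B *m X *m B = B by exact: mul_mpinv_compl_projK.
have AYA : A *m Y *m A = A by exact: mul_mpinv_compl_projK.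
have XB : X *m B = X *m (compl_proj A *m B) by exact: mpinv_compl_proj_mul.
have YA : Y *m A = Y *m (compl_proj B *m A) by exact: mpinv_compl_proj_mul.
have MZ : (A + B) *m (X + Y) = B *m X + A *m Y.
  by rewrite mulmxDl !mulmxDr AX0 BY0 add0r addr0 addrC.
have ZM : (X + Y) *m (A + B) = X *m B + Y *m A.
  by rewrite mulmxDl !mulmxDr XA0 YB0 add0r addr0.
have EA : (B *m X + A *m Y) *m A = A.
  by rewrite mulmxDl AYA -mulmxA XA0 mulmx0 add0r.
have EB : (B *m X + A *m Y) *m B = B.
  by rewrite mulmxDl BXB -(mulmxA A) YB0 mulmx0 addr0.
have EE : (B *m X + A *m Y) *m (B *m X + A *m Y) ^t* = B *m X + A *m Y.
  by rewrite {1}mulmxDl -!mulmxA !mpinv_compl_proj_adj_fix.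
apply: is_mpinv_uniq (mpinvP _) _; apply/and4P; split; apply/eqP.
- by rewrite MZ mulmxDr EA EB.
(* The cross terms contain [B *m Y] or [A *m X] and vanish; the other two are the second Penrose
   equations of [X] and [Y]. *)
- rewrite ZM mulmxDl !mulmxDr -(mulmxA X B Y) -(mulmxA Y A X) AX0 BY0 !mulmx0.
  by rewrite addr0 add0r XB YA !mpinv_mulmxK.
- by rewrite MZ -{1}EE adjmxM trmxCK EE.
- by rewrite ZM adjmxD XB YA !adjmx_mpinv_mulmx.
Qed.

End MoorePenroseTheory.

Theorem theorem2p22 (R : realType) (m n : nat) (A B : 'M[R[i]]_(m, n))
    (hBA : B *m A ^t* = 0)
    (hAB : col_space A `&` col_space B = [set 0]) :
  mpinv (A + B) =
  (A + B) ^t* *m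
    (mpinv ((compl_proj A *m B) *m (compl_proj A *m B) ^t*) +
     mpinv ((compl_proj B *m A) *m (compl_proj B *m A) ^t*)).
Proof.
(* Each summand is expanded back into its Gram form; exchanging [A] and [B] for the second one
   yields [B + A], hence the commutation. *)
rewrite mpinv_add_star_orthogonal // mulmxDr -(mpinv_compl_proj_gram A B).
by rewrite -(mpinv_compl_proj_gram B A) (addrC B A).
Qed.
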